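(* Let the data $A_i,D_i,L_i,C,\zeta,T,X_i,\Pi$ and the functions $P_i:[0,T]\to\mathbb R^{n\times n}$ be as in the context. The following are equivalent: (a) there exist $\alpha>0$, an inter-sampling time $h>0$, a Lipschitz constant $\kappa>0$, symmetric $Q\succ0$, $W\succ0$ in $\mathbb R^{n\times n}$ and $\gamma>0$ such that $\Psi_i(t)\prec0$ for all $i\in[\ell]$ and $t\in[0,T]$; (b) there exists a symmetric $Q\succ0$ in $\mathbb R^{n\times n}$ such that, for all $i\in[\ell]$ and $t\in[0,T]$, $$\Gamma_i(t):=\begin{bmatrix}-2\zeta P_i(t)&P_i(t)L_iD_i\\ \star&\Phi_i(0,Q)\end{bmatrix}\prec0 .$$
   Context: Notation: $[\ell]=\{1,\dots,\ell\}$; $\prec,\succ$ denote definiteness of symmetric matrices; $\star$ denotes entries determined by symmetry. $\mathcal M_\ell$ is the class of irreducible matrices $\Pi\in\mathbb R^{\ell\times\ell}$ with $\Pi_{ij}\ge0$ for $i\ne j$ and $\sum_j\Pi_{ij}=0$ for all $i$. Data: $A_i\in\mathbb R^{n\times n}$, $D_i\in\mathbb R^{m\times n}$, $C\in\mathbb R^{p\times n}$, with $(A_i,D_i)$ observable, and fixed $L_i\in\mathbb R^{n\times m}$ such that each $U_i:=A_i-L_iD_i$ is Hurwitz and there are a symmetric $\Omega\succ0$ and $\eta>0$ with $\Phi_i(\eta,\Omega)\prec0$ for all $i\in[\ell]$, where $\Phi_i(\eta,\Omega):=U_i^\top\Omega+\Omega U_i+2\eta\Omega$. Further, $\zeta,T>0$,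 symmetric $X_i\succ0$ and $\Pi\in\mathcal M_\ell$ satisfy, for all $i\in[\ell]$, $A_i^\top X_i+X_iA_i+\sum_{j\in[\ell]\setminus\{i\}}\Pi_{ij}(Y_{1,j}+Y_{2,j}-X_i)+C^\top C+2\zeta X_i\prec0$, with $Y_{1,j}=\mathrm e^{(A_j^\top+\zeta I)T}X_j\mathrm e^{(A_j+\zeta I)T}$ and $Y_{2,j}=\int_0^T\mathrm e^{(A_j^\top+\zeta I)\tau}C^\top C\,\mathrm e^{(A_j+\zeta I)\tau}d\tau$. $P_i:[0,T]\to\mathbb R^{n\times n}$ is the (symmetric positive definite) solution of $-\dot P_i(t)=A_i^\top P_i(t)+P_i(t)A_i+C^\top C+2\zeta P_i(t)$ on $[0,T)$ with $P_i(T)=X_i$. With $c:=h^2\mathrm e^{2\alpha h}$, $$\Psi_i(t)=\begin{bmatrix}-2(\zeta-\alpha)P_i(t)+\gamma\kappa^2I_n & P_i(t)L_iD_i+\gamma\kappa^2I_n & -P_i(t)L_iD_i & 0\\ \star&\Phi_i(\alpha,Q)+\gamma\kappa^2I_n+cU_i^\top WU_i& QL_iD_i+cU_i^\top WL_iD_i& Q+cU_i^\top W\\ \star&\star&-\frac{\pi^2}{4}W+cD_i^\top L_i^\top WL_iD_i& cD_i^\top L_i^\top W\\ \star&\star&\star&-\gamma I_n+cW\end{bmatrix}.$$ *)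

(* Defs.v *)
From HB Require Import structures.
From mathcomp Require Import all_boot all_order all_algebra.
From mathcomp Require Import complex.
From mathcomp Require Import all_classical all_reals all_analysis.

Set Implicit Arguments.
Unset Strict Implicit.
Unset Printing Implicit Defensive.

Import Order.TTheory GRing.Theory Num.Theory.
Import numFieldNormedType.Exports.

Local Open Scope classical_set_scope.
Local Open Scope ring_scope.

Section Matrices.
Context {R : realType}.

Definition posdef n (M : 'M[R]_n) : Prop :=
  M^T = M /\ forall x : 'cV[R]_n, x != 0 -> 0 < (x^T *m M *m x) 0 0.

Definition negdef n (M : 'M[R]_n) : Prop :=
  M^T = M /\ forall x : 'cV[R]_n, x != 0 -> (x^T *m M *m x) 0 0 < 0.

(* The block matrix [A B; star D], the star being determined by symmetry. *)
Definition sym_block n1 n2 (A : 'M[R]_n1) (B : 'M[R]_(n1, n2)) (D : 'M[R]_n2) :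
    'M[R]_(n1 + n2) :=
  block_mx A B B^T D.

Definition expm n (A : 'M[R]_n) : 'M[R]_n :=
  limn (series (fun k : nat => (k`!%:R)^-1 *: A ^+ k)).

Definition mx_integral n (T : R) (F : R -> 'M[R]_n) : 'M[R]_n :=
  \matrix_(i, j) Rintegral lebesgue_measure `[0, T] (fun tau => F tau i j).

(* Derivative relative to the domain S; one-sided at the endpoints of an
   interval. *)
Definition has_derivative_within n (S : set R) (F : R -> 'M[R]_n) (t : R)
    (dF : 'M[R]_n) : Prop :=
  (fun s => (s - t)^-1 *: (F s - F t)) @ within S t^' --> dF.

Definition hurwitz n (U : 'M[R]_n) : Prop :=
  forall z : R[i], eigenvalue (map_mx (real_complex R) U) z -> complex.Re z < 0.

(* For the system x' = A x, y = D x: on every interval [0, s] with s > 0 the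
   output determines the initial state. *)
Definition observable n m (A : 'M[R]_n) (D : 'M[R]_(m, n)) : Prop :=
  forall s : R, 0 < s -> forall x y : 'cV[R]_n,
    (forall t : R, 0 <= t <= s ->
      D *m expm (t *: A) *m x = D *m expm (t *: A) *m y) ->
    x = y.

(* No simultaneous row and column permutation makes the matrix block
   triangular; S is the index set of one diagonal block. *)
Definition irreducible_mx l (M : 'M[R]_l) : Prop :=
  ~ exists S : {set 'I_l}, [/\ S != finset.set0, S != [set: 'I_l]%SET &
      forall i j, i \in S -> j \notin S -> M i j = 0].

Definition transition_rate_mx l (M : 'M[R]_l) : Prop :=
  [/\ irreducible_mx M,
      forall i j, i != j -> 0 <= M i j &
      forall i, \sum_j M i j = 0].

End Matrices.

Section Observer.
Context {R : realType}.
Variables n m p : nat.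
Implicit Types (A X Q W : 'M[R]_n) (D : 'M[R]_(m, n)) (L : 'M[R]_(n, m))
  (C : 'M[R]_(p, n)).

Definition Umx A L D : 'M[R]_n := A - L *m D.

Definition Phi A L D (eta : R) (Omega : 'M[R]_n) : 'M[R]_n :=
  (Umx A L D)^T *m Omega + Omega *m Umx A L D + (2 * eta) *: Omega.

Definition Y1 A X (zeta T : R) : 'M[R]_n :=
  expm (T *: (A^T + zeta%:M)) *m X *m expm (T *: (A + zeta%:M)).

Definition Y2 A C (zeta T : R) : 'M[R]_n :=
  mx_integral T (fun tau =>
    expm (tau *: (A^T + zeta%:M)) *m C^T *m C *m expm (tau *: (A + zeta%:M))).

Definition lyapunov_solution A C X (zeta T : R) (P : R -> 'M[R]_n) : Prop :=
  [/\ {within `[0, T], continuous P},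
      forall t, 0 <= t < T ->
        exists2 dP, has_derivative_within `[0, T] P t dP &
          - dP = A^T *m P t + P t *m A + C^T *m C + (2 * zeta) *: P t &
      P T = X].

Definition Psi A L D (zeta alpha h kappa gamma : R) Q W (Pt : 'M[R]_n) :
    'M[R]_(n + (n + (n + n))) :=
  let U := Umx A L D in
  let c := h ^+ 2 * expR (2 * alpha * h) in
  let g := (gamma * kappa ^+ 2)%:M in
  sym_block
    (- (2 * (zeta - alpha)) *: Pt + g)
    (row_mx (Pt *m L *m D + g) (row_mx (- (Pt *m L *m D)) 0))
    (sym_block
       (Phi A L D alpha Q + g + c *: (U^T *m W *m U))
       (row_mx (Q *m L *m D + c *: (U^T *m W *m L *m D))
               (Q + c *: (U^T *m W)))
       (sym_block
          (- (pi ^+ 2 / 4) *: W + c *: (D^T *m L^T *m W *m L *m D))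
          (c *: (D^T *m L^T *m W))
          (- gamma%:M + c *: W))).

Definition Gamma A L D (zeta : R) Q (Pt : 'M[R]_n) : 'M[R]_(n + n) :=
  sym_block (- (2 * zeta) *: Pt) (Pt *m L *m D) (Phi A L D 0 Q).

End Observer.

(* Main.v *)
Require Import Defs.
From HB Require Import structures.
From mathcomp Require Import all_boot all_order all_algebra.
From mathcomp Require Import all_classical all_reals all_analysis.
From mathcomp Require Import ring lra.

Set Implicit Arguments.
Unset Strict Implicit.
Unset Printing Implicit Defensive.

Import Order.TTheory GRing.Theory Num.Theory.
Import numFieldNormedType.Exports.

Local Open Scope ring_scope.

(** Restrict the quadratic form of Psi to vectors (x, y, 0, 0): it exceeds that
    of Gamma by 2 alpha (x'Px + y'Qy) plus terms that are clearly nonnegative.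
    The upper left block of Psi at t = T, where P(T) = X > 0, forces
    alpha < zeta; the same block at t then gives P(t) > 0, so Gamma < 0.
    Conversely, by compactness of [0, T] and of the unit sphere there is K >= 1
    with Gamma <= - K^-1 I and all other matrices bounded by K, uniformly in i
    and t.  With W = gamma I and gamma = 16 K^4, the cross terms with z and w
    are absorbed by the diagonal, and what remains is small once alpha,
    gamma kappa^2 and h^2 exp(2 alpha h) are. *)

(** * Bilinear and quadratic forms of block matrices *)

Section BilinearForms.
Context {R : realType}.

(** Convertible to the expression in [posdef] and [negdef], whence the folds [-/(bil _ _ _)] later
    on. *)
Definition bil n m (M : 'M[R]_(n, m)) (x : 'cV[R]_n) (y : 'cV[R]_m) : R :=
  (x^T *m M *m y) 0 0.

Definition sq n (x : 'cV[R]_n) : R := (x^T *m x) 0 0.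

Lemma bilDm n m (M N : 'M[R]_(n, m)) x y :
  bil (M + N) x y = bil M x y + bil N x y.
Proof. by rewrite /bil mulmxDr mulmxDl mxE. Qed.

Lemma bilNm n m (M : 'M[R]_(n, m)) x y : bil (- M) x y = - bil M x y.
Proof. by rewrite /bil mulmxN mulNmx mxE. Qed.

Lemma bilZm n m a (M : 'M[R]_(n, m)) x y : bil (a *: M) x y = a * bil M x y.
Proof. by rewrite /bil -scalemxAr -scalemxAl mxE. Qed.

Lemma bil0m n m (x : 'cV[R]_n) (y : 'cV[R]_m) : bil 0 x y = 0.
Proof. by rewrite /bil mulmx0 mul0mx mxE. Qed.

Lemma bilDl n m (M : 'M[R]_(n, m)) x x' y :
  bil M (x + x') y = bil M x y + bil M x' y.
Proof. by rewrite /bil linearD /= !mulmxDl mxE. Qed.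

Lemma bilDr n m (M : 'M[R]_(n, m)) x y y' :
  bil M x (y + y') = bil M x y + bil M x y'.
Proof. by rewrite /bil mulmxDr mxE. Qed.

Lemma bil0r n m (M : 'M[R]_(n, m)) x : bil M x 0 = 0.
Proof. by rewrite /bil mulmx0 mxE. Qed.

Lemma bil_tr n m (M : 'M[R]_(n, m)) x y : bil M^T y x = bil M x y.
Proof. by rewrite /bil -[in LHS](trmxK x) -!trmx_mul mxE mulmxA. Qed.

Lemma bilC n (M : 'M[R]_n) x y : M^T = M -> bil M x y = bil M y x.
Proof. by move=> MT; rewrite -bil_tr MT. Qed.

Lemma bilMr n m k (M : 'M[R]_(n, m)) (N : 'M[R]_(m, k)) x y :
  bil (M *m N) x y = bil M x (N *m y).
Proof. by rewrite /bil !mulmxA. Qed.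

Lemma bilMl n m k (M : 'M[R]_(m, n)) (N : 'M[R]_(m, k)) x y :
  bil (M^T *m N) x y = bil N (M *m x) y.
Proof. by rewrite /bil trmx_mul !mulmxA. Qed.

Lemma bil_scalar n a (x : 'cV[R]_n) : bil a%:M x x = a * sq x.
Proof. by rewrite /bil /sq mul_mx_scalar -scalemxAl mxE. Qed.

Lemma bil_row_mx n m k (M : 'M[R]_(n, m)) (N : 'M[R]_(n, k)) x y z :
  bil (row_mx M N) x (col_mx y z) = bil M x y + bil N x z.
Proof. by rewrite /bil mul_mx_row mul_row_col mxE. Qed.

Lemma bil_sym_block n m (M : 'M[R]_n) (B : 'M[R]_(n, m)) (N : 'M[R]_m) x y :
  bil (sym_block M B N) (col_mx x y) (col_mx x y) =
  bil M x x + 2 * bil B x y + bil N y y.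
Proof.
rewrite /bil /sym_block tr_col_mx mul_row_block mul_row_col !mulmxDl.
rewrite mxE [X in X + _]mxE [X in _ + X]mxE -!/(bil _ _ _) bil_tr; ring.
Qed.

Lemma bil_sum n m (M : 'M[R]_(n, m)) x y :
  bil M x y = \sum_i \sum_j x i 0 * M i j * y j 0.
Proof.
rewrite /bil mxE exchange_big /=; apply: eq_bigr => j _.
by rewrite mxE mulr_suml; apply: eq_bigr => i _; rewrite mxE.
Qed.

Lemma sq_sum n (x : 'cV[R]_n) : sq x = \sum_i x i 0 ^+ 2.
Proof. by rewrite /sq mxE; apply: eq_bigr => i _; rewrite mxE expr2. Qed.

Lemma sq_ge0 n (x : 'cV[R]_n) : 0 <= sq x.
Proof. by rewrite sq_sum; apply: sumr_ge0 => i _; exact: sqr_ge0. Qed.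

Lemma sq0 n : sq (0 : 'cV[R]_n) = 0.
Proof. by rewrite /sq mulmx0 mxE. Qed.

Lemma sq_eq0 n (x : 'cV[R]_n) : (sq x == 0) = (x == 0).
Proof.
rewrite sq_sum psumr_eq0; last by move=> i _; exact: sqr_ge0.
apply/allP/eqP => [x0|-> i _]; last by rewrite mxE expr0n /=.
apply/colP => i; apply/eqP; rewrite mxE -sqrf_eq0.
exact: x0 (mem_index_enum i).
Qed.

Lemma sq_gt0 n (x : 'cV[R]_n) : x != 0 -> 0 < sq x.
Proof. by move=> x0; rewrite lt_def sq_eq0 x0 sq_ge0. Qed.

Lemma sq_col_mx n m (x : 'cV[R]_n) (y : 'cV[R]_m) :
  sq (col_mx x y) = sq x + sq y.
Proof. by rewrite /sq tr_col_mx mul_row_col mxE. Qed.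

Lemma sqZ n a (x : 'cV[R]_n) : sq (a *: x) = a ^+ 2 * sq x.
Proof.
rewrite /sq [(a *: x)^T]linearZ /= -scalemxAr [in LHS]mxE.
by rewrite -scalemxAl mxE mulrA expr2.
Qed.

Lemma bilZ n (M : 'M[R]_n) a x : bil M (a *: x) (a *: x) = a ^+ 2 * bil M x x.
Proof.
rewrite /bil [(a *: x)^T]linearZ /= -scalemxAr [in LHS]mxE.
by rewrite -!scalemxAl mxE mulrA expr2.
Qed.

Lemma sqD_le n (x y : 'cV[R]_n) : sq (x + y) <= 2 * (sq x + sq y).
Proof.
rewrite !sq_sum -big_split mulr_sumr; apply: ler_sum => i _ /=.
rewrite mxE; have := sqr_ge0 (x i 0 - y i 0); nra.
Qed.

Lemma sqD3_le n (x y z : 'cV[R]_n) : sq (x + y + z) <= 3 * (sq x + sq y + sq z).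
Proof.
rewrite !sq_sum -!big_split mulr_sumr; apply: ler_sum => i _ /=; rewrite !mxE.
have := sqr_ge0 (x i 0 - y i 0); have := sqr_ge0 (x i 0 - z i 0).
have := sqr_ge0 (y i 0 - z i 0); nra.
Qed.

Lemma sym_block_trE n m (M : 'M[R]_n) (B : 'M[R]_(n, m)) (N : 'M[R]_m) :
  (sym_block M B N)^T = sym_block M B N <-> M^T = M /\ N^T = N.
Proof.
rewrite /sym_block tr_block_mx trmxK; split=> [/eq_block_mx[]|[-> ->]] //.
Qed.

Lemma posdef_ge0 n (M : 'M[R]_n) x : posdef M -> 0 <= bil M x x.
Proof.
move=> [_ M0]; have [->|x0] := eqVneq x 0; first by rewrite bil0r.
exact/ltW/M0.
Qed.

Lemma posdef_scalar n (a : R) : 0 < a -> posdef (a%:M : 'M[R]_n).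
Proof.
move=> a0; split=> [|x x0]; first by rewrite tr_scalar_mx.
by rewrite -/(bil _ _ _) bil_scalar mulr_gt0 // sq_gt0.
Qed.

End BilinearForms.

(** * Uniform bounds from compactness *)

Section Compactness.
Local Open Scope classical_set_scope.
Local Open Scope ring_scope.
Context {R : realType}.

(** The entries of the matrices in [S] have a common bound, and each product of coordinates falls to
    Young's inequality with weight [s]; summation gives the factor [n + m]. The weight stays free so
    that most of a cross term can later be charged to one of its variables. With [K] near infinity,
    several bounds can share one constant. *)
Lemma bil_bound n m (S : set 'M[R]_(n, m)) : bounded_set S ->
  \forall K \near +oo, forall M, S M -> forall x y s, 0 < s ->
    2 * `|bil M x y| <= K * (s * sq x + s^-1 * sq y).
Proof.
move=> /pinfty_ex_gt0[B B0 SB].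
exists (B * (n%:R + m%:R)); split; first exact: num_real.
move=> K /ltW BK M SM x y s s0.
have bnd i j : `|M i j| <= B.
  apply: le_trans (SB M SM); rewrite [leRHS]/Num.norm /= mx_normrE.
  by apply/bigmax_geP; right => /=; exists (i, j).
have sV0 : 0 < s^-1 by rewrite invr_gt0.
have ss : s * s^-1 = 1 by rewrite divff // gt_eqF.
have sqs0 : 0 <= s * sq x + s^-1 * sq y.
  by rewrite addr_ge0 // mulr_ge0 ?sq_ge0 // ltW.
apply: le_trans (ler_wpM2r sqs0 BK).
apply: (@le_trans _ _ (\sum_(i < n) \sum_(j < m)
    B * (s * x i 0 ^+ 2 + s^-1 * y j 0 ^+ 2))).
  rewrite bil_sum; apply: le_trans (ler_wpM2l _ (ler_norm_sum _ _ _)) _ => //.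
  rewrite mulr_sumr; apply: ler_sum => i _.
  apply: le_trans (ler_wpM2l _ (ler_norm_sum _ _ _)) _ => //.
  rewrite mulr_sumr; apply: ler_sum => j _.
  rewrite !normrM -(real_normK (num_real (x i 0))).
  rewrite -(real_normK (num_real (y j 0))).
  have := bnd i j; have := normr_ge0 (M i j).
  have := normr_ge0 (x i 0); have := normr_ge0 (y j 0).
  set a := `|x i 0|; set b := `|y j 0|; set c := `|M i j| => b0 a0 c0 cB.
  have h : 2 * (a * b) <= s * a ^+ 2 + s^-1 * b ^+ 2.
    (* Completing the square. The identity is formal in [s] and [s^-1]; its last summand vanishes
       because [s * s^-1 = 1]. *)
    have -> : s * a ^+ 2 + s^-1 * b ^+ 2 =
        s * (a - s^-1 * b) ^+ 2 + 2 * (a * b) * (s * s^-1)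
        + s^-1 * b ^+ 2 * (1 - s * s^-1) by ring.
    rewrite ss subrr mulr0 addr0 mulr1 lerDr.
    by rewrite mulr_ge0 ?sqr_ge0 // ltW.
  have ab0 : 0 <= 2 * (a * b) by rewrite !mulr_ge0.
  have -> : 2 * (a * c * b) = c * (2 * (a * b)) by ring.
  by apply: ler_pM.
under eq_bigr do rewrite -mulr_sumr big_split /= sumr_const card_ord -mulr_sumr.
rewrite -mulr_sumr big_split /= sumr_const card_ord -!sq_sum.
rewrite -mulrA ler_pM2l //.
under eq_bigr do rewrite -mulrnAl.
rewrite -mulr_sumr -sq_sum -mulrnAl -(mulr_natl s) -(mulr_natl s^-1).
rewrite !mulrDr !mulrDl.
have := sq_ge0 x; have := sq_ge0 y.
have : 0 <= n%:R :> R by []. have : 0 <= m%:R :> R by [].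
move: s s^-1 s0 sV0 {ss sqs0} => s t s0 t0 m0 n0 y0 x0.
have : 0 <= n%:R * (s * sq x) by rewrite !mulr_ge0 // ltW.
have : 0 <= m%:R * (t * sq y) by rewrite !mulr_ge0 // ltW.
lra.
Qed.

Lemma continuous_sumr (T : topologicalType) k (F : 'I_k -> T -> R) :
  (forall i, continuous (F i)) -> continuous (fun x => \sum_i F i x).
Proof. by move=> Fc; apply: continuous_big => //; exact: add_continuous. Qed.

(** The sphere is closed and lies in the box [-1, 1]^n. Row vectors are used to fit [rV_compact]. *)
Lemma compact_sphere n :
  compact [set v : 'rV[R]_n | sq v^T = 1].
Proof.
have cl : closed [set v : 'rV[R]_n | sq v^T = 1].
  apply: (@preimage_closed _ _ (fun v : 'rV[R]_n => sq v^T) [set 1]).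
    move=> v _; rewrite (_ : (fun _ => _) =
        fun v : 'rV[R]_n => \sum_i v 0 i * v 0 i).
      apply: continuous_sumr => i {}v.
      by apply: continuousM; apply: coord_continuous.
    apply/funext => w; rewrite sq_sum; apply: eq_bigr => i _.
    by rewrite mxE expr2.
  exact: closed_eq.
have box :
    compact [set v : 'rV[R]_n | forall i, `[(- 1 : R), 1]%classic (v ord0 i)].
  apply: (@rV_compact _ _ (fun=> `[(- 1 : R), 1]%classic)) => _.
  exact: segment_compact.
apply: subclosed_compact cl box _ => v /= v1 i.
rewrite in_itv /= -ler_norml -(@ler_sqr _ `|_| 1) ?nnegrE // expr1n.
rewrite real_normK ?num_real // -v1.
rewrite sq_sum (bigD1 i) //= mxE lerDl.
by apply: sumr_ge0 => j _; exact: sqr_ge0.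
Qed.

(** The form is continuous on the compact product of [S] and the unit sphere, so its image is
    closed; it misses 0, hence a whole ball of radius [e] about 0. The values are negative, so they
    are at most [- e], and homogeneity carries this to all vectors as soon as [K > e^-1]. *)
Lemma uniformly_negdef (T : topologicalType) n (S : set T) (G : T -> 'M[R]_n) :
  compact S -> (forall i j, continuous (fun t => G t i j)) ->
  (forall t, S t -> negdef (G t)) ->
  \forall K \near +oo, forall t, S t -> forall x, bil (G t) x x <= - K^-1 * sq x.
Proof.
move=> cS cG negG.
pose f (tv : T * 'rV[R]_n) : R := bil (G tv.1) tv.2^T tv.2^T.
pose V := [set v : 'rV[R]_n | sq v^T = 1].
have cf : continuous f.
  have -> : f = fun tv => \sum_i \sum_j tv.2 0 i * G tv.1 i j * tv.2 0 j.
    apply/funext => tv; rewrite /f bil_sum; apply: eq_bigr => i _.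
    by apply: eq_bigr => j _; rewrite !mxE.
  apply: continuous_sumr => i; apply: continuous_sumr => j [u w].
  have c2 k : (fun uw : T * 'rV[R]_n => uw.2 0 k) @ (u, w) --> w 0 k.
    apply: (@cvg_comp _ _ _ snd (fun v : 'rV[R]_n => v 0 k)).
      exact: cvg_snd.
    exact: coord_continuous.
  have c1 : (fun uw : T * 'rV[R]_n => G uw.1 i j) @ (u, w) --> G u i j.
    by apply: (@cvg_comp _ _ _ fst (fun t => G t i j));
      [exact: cvg_fst|exact: cG].
  exact: cvgM (cvgM (c2 i) c1) (c2 j).
have cI : closed (f @` (S `*` V)).
  apply: compact_closed => //; apply: continuous_compact.
    exact/continuous_subspaceT.
  by apply: compact_setX => //; exact: compact_sphere.
have n0 : (~` (f @` (S `*` V))) 0.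
  move=> [[t v] /= [St v1]] /eqP; rewrite lt_eqF //.
  apply: (negG t St).2; apply: contra_eqN v1 => /eqP->.
  by rewrite sq0 eq_sym oner_neq0.
have /open_nbhs_nbhs/nbhs_ballP[e /= e0 eV] := conj (closed_openC cI) n0.
exists e^-1; split; first exact: num_real.
move=> K eK t St x; have [->|x0] := eqVneq x 0.
  by rewrite bil0r sq0 mulr0.
have K0 : 0 < K by apply: lt_trans eK; rewrite invr_gt0.
have sx : 0 < sq x := sq_gt0 x0.
pose a := Num.sqrt (sq x).
have a0 : a != 0 by rewrite gt_eqF // sqrtr_gt0.
have aa : a ^+ 2 = sq x by rewrite sqr_sqrtr // ltW.
pose y := a^-1 *: x.
have xy : x = a *: y by rewrite scalerA divff // scale1r.
have y1 : sq y = 1 by rewrite sqZ -aa exprVn mulVf // expf_neq0.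
have y0 : y != 0.
  by apply: contra_eqN y1 => /eqP->; rewrite sq0 eq_sym oner_neq0.
have fy : bil (G t) y y <= - e.
  rewrite leNgt; apply/negP => eG.
  have Gy0 : bil (G t) y y < 0 by exact: (negG t St).2.
  have Gye : ball 0 e (bil (G t) y y).
    by rewrite -ball_normE /= sub0r normrN ltr0_norm // ltrNl.
  apply: (eV _ Gye).
  by exists (t, y^T); rewrite /f /= ?trmxK //; split => //=; rewrite /V /= trmxK.
rewrite {1 2}xy bilZ aa mulrC ler_pM2r //; apply: le_trans fy _.
by rewrite lerN2 -[leRHS]invrK lef_pV2 ?posrE ?invr_gt0 // ltW.
Qed.

End Compactness.

(** * The quadratic forms of Psi and Gamma *)

Section Observer.
Context {R : realType}.
Variables n m : nat.
Implicit Types (A Q W Pt X : 'M[R]_n) (D : 'M[R]_(m, n)) (L : 'M[R]_(n, m))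
  (zeta alpha h kappa gamma : R).

Lemma bil_Gamma A L D zeta Q Pt x y :
  bil (Gamma A L D zeta Q Pt) (col_mx x y) (col_mx x y) =
  - (2 * zeta) * bil Pt x x + 2 * bil Pt x (L *m D *m y)
  + bil (Phi A L D 0 Q) y y.
Proof. by rewrite bil_sym_block bilZm -mulmxA bilMr. Qed.

(** The terms with factor [alpha] split off from the first two diagonal blocks, those with
    [gamma * kappa ^+ 2] form one square of [x + y], and those with [h ^+ 2 * expR (2 * alpha * h)]
    are the expansion of the form of [W] at [u]. *)
Lemma bil_Psi A L D zeta alpha h kappa gamma Q W Pt x y z w : W^T = W ->
  let v := col_mx x (col_mx y (col_mx z w)) in
  let u := Umx A L D *m y + L *m D *m z + w in
  bil (Psi A L D zeta alpha h kappa gamma Q W Pt) v v =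
  bil (Gamma A L D zeta Q Pt) (col_mx x y) (col_mx x y)
  + 2 * alpha * (bil Pt x x + bil Q y y)
  + gamma * kappa ^+ 2 * sq (x + y)
  - 2 * bil Pt x (L *m D *m z) + 2 * bil Q y (L *m D *m z) + 2 * bil Q y w
  - pi ^+ 2 / 4 * bil W z z - gamma * sq w
  + h ^+ 2 * expR (2 * alpha * h) * bil W u u.
Proof.
move=> WT /=; set U := Umx A L D; set c := h ^+ 2 * _; set g := gamma * _.
rewrite bil_Gamma /Psi /Phi -/U -/c -/g !bil_sym_block !bil_row_mx.
rewrite !(bilDm, bilNm, bilZm, bil0m) -!bil_scalar.
rewrite -!mulmxA !(bilMl, bilMr) -!mulmxA !(bilDl, bilDr).
rewrite (bilC (L *m (D *m z)) (U *m y) WT) (bilC w (U *m y) WT).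
rewrite (bilC w (L *m (D *m z)) WT) (bilC y x (tr_scalar_mx _ g)).
ring.
Qed.

Lemma Phi_sym A L D eta Q : Q^T = Q -> (Phi A L D eta Q)^T = Phi A L D eta Q.
Proof.
move=> QT; rewrite /Phi 2!linearD linearZ /= !trmx_mul trmxK QT.
by rewrite [X in X + _]addrC.
Qed.

Lemma Psi_sym A L D zeta alpha h kappa gamma Q W Pt :
  Pt^T = Pt -> Q^T = Q -> W^T = W ->
  (Psi A L D zeta alpha h kappa gamma Q W Pt)^T =
  Psi A L D zeta alpha h kappa gamma Q W Pt.
Proof.
move=> PT QT WT; apply/sym_block_trE; split.
  by rewrite linearD linearZ /= PT tr_scalar_mx.
apply/sym_block_trE; split.
  rewrite 2!linearD linearZ /= Phi_sym // tr_scalar_mx.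
  by rewrite !trmx_mul trmxK WT mulmxA.
apply/sym_block_trE; split.
  by rewrite linearD !linearZ /= !trmx_mul !trmxK WT !mulmxA.
by rewrite linearD linearN linearZ /= tr_scalar_mx WT.
Qed.

Lemma Gamma_sym A L D zeta Q Pt : Pt^T = Pt -> Q^T = Q ->
  (Gamma A L D zeta Q Pt)^T = Gamma A L D zeta Q Pt.
Proof.
move=> PT QT; apply/sym_block_trE; split; last exact: Phi_sym.
by rewrite linearZ /= PT.
Qed.

(** [lyapunov_solution] does not state that P(t) is symmetric; the upper left block -2 zeta P(t) of
    Gamma reveals it. *)
Lemma negdef_Gamma_sym A L D zeta Q Pt : 0 < zeta ->
  negdef (Gamma A L D zeta Q Pt) -> Pt^T = Pt.
Proof.
move=> z0 [/sym_block_trE[/eqP + _] _]; rewrite linearZ /= => /eqP.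
by apply: scalerI; rewrite oppr_eq0 mulf_neq0 ?pnatr_eq0 // gt_eqF.
Qed.

(** * From Psi to Gamma *)

Lemma Psi_upper_left_bound A L D zeta alpha h kappa gamma Q W Pt x :
  negdef (Psi A L D zeta alpha h kappa gamma Q W Pt) -> x != 0 ->
  gamma * kappa ^+ 2 * sq x < 2 * (zeta - alpha) * bil Pt x x.
Proof.
move=> [_ /(_ (col_mx x 0))] Psi_neg x0.
have /Psi_neg : col_mx x 0 != 0 :> 'cV[R]_(n + (n + (n + n))).
  by rewrite col_mx_eq0 negb_and x0.
rewrite -/(bil _ _ _) bil_sym_block bil0r bil0r mulr0 !addr0.
by rewrite bilDm bilZm bil_scalar mulNr addrC subr_lt0.
Qed.

(** [X] stands for P(T), the value of P whose positivity is given; the sign of [zeta - alpha] found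
    there passes positivity on to [Pt]. *)
Lemma negdef_Gamma_of_Psi A L D zeta alpha h kappa gamma Q W Pt X :
  0 < alpha -> 0 < gamma -> posdef Q -> posdef W -> posdef X ->
  negdef (Psi A L D zeta alpha h kappa gamma Q W Pt) ->
  negdef (Psi A L D zeta alpha h kappa gamma Q W X) ->
  negdef (Gamma A L D zeta Q Pt).
Proof.
move=> alpha0 gamma0 Q0 W0 X0 PsiP PsiX.
have g0 : 0 <= gamma * kappa ^+ 2 by rewrite mulr_ge0 ?sqr_ge0 ?ltW.
(* The nonzero vector is an argument because none exists for [n = 0], where [alpha < zeta] may
   fail. *)
have alpha_lt (x : 'cV[R]_n) : x != 0 -> alpha < zeta.
  move=> x0; have := Psi_upper_left_bound PsiX x0.
  have := mulr_ge0 g0 (sq_ge0 x); have /X0.2 := x0; rewrite -/(bil _ _ _).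
  by move=> Xx gx h1; rewrite ltNge; apply/negP => za; nra.
have P0 x : 0 <= bil Pt x x.
  have [->|x0] := eqVneq x 0; first by rewrite bil0r.
  have := Psi_upper_left_bound PsiP x0; have := mulr_ge0 g0 (sq_ge0 x).
  have := alpha_lt x x0; nra.
split=> [|xy].
  apply: Gamma_sym Q0.1; apply/matrixP => i j.
  (* An index [i] yields a nonzero vector, so [zeta - alpha] is nonzero and can be cancelled in the
     symmetry of the upper left block. *)
  have i0 : delta_mx i 0 != 0 :> 'cV[R]_n.
    apply/eqP => /colP/(_ i); rewrite !mxE !eqxx => /eqP.
    by rewrite oner_eq0.
  have az := alpha_lt _ i0.
  have [/sym_block_trE[+ _] _] := PsiP; rewrite linearD linearZ /= tr_scalar_mx.
  move=> /addIr/scalerI -> //.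
  by rewrite oppr_eq0 mulf_neq0 ?pnatr_eq0 // subr_eq0 gt_eqF.
rewrite -[xy]vsubmxK; move: (usubmx xy) (dsubmx xy) => x y xy0.
pose v : 'cV[R]_(n + (n + (n + n))) := col_mx x (col_mx y (col_mx 0 0)).
have v0 : v != 0.
  apply: contraNneq xy0; rewrite /v => /eqP.
  by rewrite col_mx_eq0 col_mx_eq0 => /and3P[/eqP-> /eqP-> _]; rewrite col_mx0.
have := PsiP.2 v v0; rewrite -!/(bil _ _ _) bil_Psi ?W0.1 //.
set u := Umx A L D *m y + _ + _; rewrite !mulmx0 !bil0r.
have := P0 x; have := posdef_ge0 y Q0; have Wu := posdef_ge0 u W0.
have cW : 0 <= h ^+ 2 * expR (2 * alpha * h) * bil W u u.
  by apply: mulr_ge0 => //; rewrite mulr_ge0 ?sqr_ge0 ?expR_ge0.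
have := mulr_ge0 g0 (sq_ge0 (x + y)); rewrite sq0.
nra.
Qed.

(** * From Gamma to Psi: choice of parameters and negativity *)

Lemma small_parameters (K w mu : R) : 1 <= K -> 1 <= w -> 0 < mu <= 1 ->
  exists alpha h kappa : R, [/\ 0 < alpha, 0 < h, 0 < kappa, alpha * K <= mu
    & w * kappa ^+ 2 <= mu /\ 3 * w * K * (h ^+ 2 * expR (2 * alpha * h)) <= mu].
Proof.
move=> K1 w1 /andP[mu0 mu1].
have K0 : 0 < K by apply: lt_le_trans K1.
have w0 : 0 < w by apply: lt_le_trans w1.
have e1 : 1 <= expR (2 : R) by rewrite -expR0 ler_expR.
have e0 := expR_gt0 (2 : R).
have d0 : 0 < 3 * w * K * expR 2 by rewrite !mulr_gt0.
(* Both [alpha] and [h] are at most 1, so the exponential is at most [expR 2] and [h ^+ 2 <= h]; the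
   last condition then reduces to [3 * w * K * (h * expR 2) = mu], which defines [h]. *)
exists (mu / K), (mu / (3 * w * K * expR 2)), (Num.sqrt (mu / w)).
have al1 : mu / K <= 1 by rewrite ler_pdivrMr // mul1r (le_trans mu1).
have h0 : 0 < mu / (3 * w * K * expR 2) by rewrite divr_gt0.
have d1 : 1 <= 3 * w * K * expR 2.
  have : 1 <= w * K by rewrite mulr_ege1.
  move=> wK; rewrite mulr_ege1 // -mulrA mulr_ege1 //; lra.
have h1 : mu / (3 * w * K * expR 2) <= 1.
  by rewrite ler_pdivrMr // mul1r (le_trans mu1).
split; [by rewrite divr_gt0 | by [] | | | ].
- by rewrite sqrtr_gt0 divr_gt0.
- by rewrite divfK // gt_eqF.
rewrite sqr_sqrtr; last by rewrite divr_ge0 ?ltW.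
split; first by rewrite mulrC divfK // gt_eqF.
set h := mu / _ in h0 h1 *; set al := mu / K in al1 *.
have al0 : 0 < al by rewrite divr_gt0.
have ee : expR (2 * al * h) <= expR 2.
  rewrite ler_expR -mulrA ger_pMr //; exact: mulr_ile1 (ltW al0) (ltW h0) al1 h1.
have -> : mu = 3 * w * K * (h * expR 2).
  rewrite mulrCA mulrA [LHS](_ : _ = h * (3 * w * K * expR 2)); first by ring.
  by rewrite divfK // gt_eqF.
rewrite ler_pM2l ?mulr_gt0 //; apply: ler_pM => //; rewrite ?sqr_ge0 ?expR_ge0 //.
by rewrite expr2 ger_pMr.
Qed.

(** Here [w] is the number gamma, and the last component of the vector is called [u]. Of the decay
    rate [K^-1] given by Gamma, the perturbations spend at most 3/8 in [x] and 21/32 in [y]. In [z]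
    and [u] the cross terms cost at most [8 * K ^+ 4] and [4 * K ^+ 3], plus [K^-1 / 32] each,
    against at least [w = 16 * K ^+ 4]. *)
Lemma bil_Psi_lt0 A L D zeta alpha h kappa Q Pt (K : R) (w := 16 * K ^+ 4) :
  1 <= K -> 0 <= alpha ->
  alpha * K <= K^-1 / 32 -> w * kappa ^+ 2 <= K^-1 / 32 ->
  3 * w * K * (h ^+ 2 * expR (2 * alpha * h)) <= K^-1 / 32 ->
  (forall v : 'cV[R]_(n + n), bil (Gamma A L D zeta Q Pt) v v <= - K^-1 * sq v) ->
  (forall x y (s : R), 0 < s ->
    2 * `|bil Pt x y| <= K * (s * sq x + s^-1 * sq y)) ->
  (forall x y (s : R), 0 < s ->
    2 * `|bil Q x y| <= K * (s * sq x + s^-1 * sq y)) ->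
  (forall x, sq (Umx A L D *m x) <= K * sq x) ->
  (forall x, sq (L *m D *m x) <= K * sq x) ->
  forall v, v != 0 -> bil (Psi A L D zeta alpha h kappa w Q w%:M Pt) v v < 0.
Proof.
move=> K1 alpha0 alphaK kappaw hw GammaK PK QK UK LK v.
rewrite -[v]vsubmxK -[dsubmx v]vsubmxK -[dsubmx (dsubmx v)]vsubmxK.
move: (usubmx v) (usubmx (dsubmx v)) (usubmx (dsubmx (dsubmx v)))
  (dsubmx (dsubmx (dsubmx v))) => x y z u v0.
have K0 : 0 < K by apply: lt_le_trans K1.
have w0 : 0 < w by rewrite mulr_gt0 // exprn_gt0.
rewrite bil_Psi ?tr_scalar_mx // !bil_scalar.
set c := h ^+ 2 * _ in hw *.
have c0 : 0 <= c by rewrite mulr_ge0 ?sqr_ge0 ?expR_ge0.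
have mu0 : 0 < K^-1 by rewrite invr_gt0.
have mu1 : K^-1 <= 1 by rewrite invf_le1.
have K3 : 1 <= K ^+ 3 by rewrite exprn_ege1.
have K4 : K ^+ 3 <= K ^+ 4 by rewrite ler_weXn2l.
have cross (M : 'M[R]_n) : (forall x y (s : R), 0 < s ->
      2 * `|bil M x y| <= K * (s * sq x + s^-1 * sq y)) ->
    forall a b, 2 * `|bil M a b| <= K^-1 / 4 * sq a + 4 * K ^+ 3 * sq b.
  move=> MK a b.
  (* Young's inequality with this weight costs only a quarter of the decay
     rate K^-1 in the first variable. *)
  have s0 : 0 < K^-1 ^+ 2 / 4 by rewrite divr_gt0 // exprn_gt0.
  apply: le_trans (MK a b _ s0) _; rewrite le_eqVlt; apply/orP; left; apply/eqP.
  by field; rewrite gt_eqF.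
have diag (M : 'M[R]_n) : (forall x y (s : R), 0 < s ->
      2 * `|bil M x y| <= K * (s * sq x + s^-1 * sq y)) ->
    forall a, alpha * bil M a a <= K^-1 / 32 * sq a.
  move=> MK a; have := MK a a 1 ltr01; rewrite invr1 !mul1r => Ma.
  have {}Ma : bil M a a <= K * sq a by have := ler_norm (bil M a a); lra.
  apply: le_trans (ler_wpM2l alpha0 Ma) _.
  by rewrite mulrA ler_wpM2r // sq_ge0.
have PL : 2 * `|bil Pt x (L *m D *m z)| <= K^-1 / 4 * sq x + 4 * K ^+ 4 * sq z.
  apply: le_trans (cross _ PK _ _) _; rewrite lerD2l.
  rewrite [leRHS](_ : _ = 4 * K ^+ 3 * (K * sq z)); last by ring.
  by rewrite ler_wpM2l // mulr_ge0 // exprn_ge0 // ltW.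
have QL : 2 * `|bil Q y (L *m D *m z)| <= K^-1 / 4 * sq y + 4 * K ^+ 4 * sq z.
  apply: le_trans (cross _ QK _ _) _; rewrite lerD2l.
  rewrite [leRHS](_ : _ = 4 * K ^+ 3 * (K * sq z)); last by ring.
  by rewrite ler_wpM2l // mulr_ge0 // exprn_ge0 // ltW.
have Qu := cross _ QK y u.
have Px := diag _ PK x; have Qy := diag _ QK y.
have gxy : w * kappa ^+ 2 * sq (x + y) <= K^-1 / 32 * (2 * (sq x + sq y)).
  apply: ler_pM => //; [|exact: sq_ge0|exact: sqD_le].
  by rewrite mulr_ge0 ?sqr_ge0 // ltW.
have x0 := sq_ge0 x; have y0 := sq_ge0 y.
have z0 := sq_ge0 z; have u0 := sq_ge0 u.
(* The factor 3 comes from the square of a sum of three vectors, [K] from the bounds on [Umx A L D]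
   and [L *m D], and [w] from [W]; this explains the third smallness condition. *)
have cW : c * (w * sq (Umx A L D *m y + L *m D *m z + u)) <=
    K^-1 / 32 * (sq y + sq z + sq u).
  have S : sq (Umx A L D *m y + L *m D *m z + u) <= 3 * K * (sq y + sq z + sq u).
    apply: le_trans (sqD3_le _ _ _) _; rewrite -mulrA ler_pM2l // !mulrDr.
    rewrite !lerD // ler_peMl //.
  have cw0 : 0 <= c * w by rewrite mulr_ge0 // ltW.
  rewrite mulrA; apply: le_trans (ler_wpM2l cw0 S) _.
  rewrite mulrA; apply: ler_wpM2r; first by rewrite !addr_ge0.
  by apply: le_trans hw; rewrite le_eqVlt; apply/orP; left; apply/eqP; ring.
have piz : w * sq z <= pi ^+ 2 / 4 * (w * sq z).
  apply: ler_peMl; first by rewrite mulr_ge0 // ltW.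
  by have := pi_ge2 R; nra.
have pos : 0 < sq x + sq y + sq z + sq u.
  by rewrite -!addrA -!sq_col_mx sq_gt0.
have := GammaK (col_mx x y); rewrite sq_col_mx => Gxy.
have := ler_norm (- bil Pt x (L *m D *m z)); rewrite normrN => nP.
have nQ := ler_norm (bil Q y (L *m D *m z)); have nu := ler_norm (bil Q y u).
(* For [lra], products such as [K^-1 * sq z] are atoms; these facts supply their signs and
   comparisons. *)
have dpos := mulr_gt0 mu0 pos.
have dx0 := mulr_ge0 (ltW mu0) x0; have dy0 := mulr_ge0 (ltW mu0) y0.
have dz0 := mulr_ge0 (ltW mu0) z0; have du0 := mulr_ge0 (ltW mu0) u0.
have dz := ler_wpM2r z0 mu1; have du := ler_wpM2r u0 mu1.
have k4z := ler_wpM2r z0 (le_trans K3 K4).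
have k3u := ler_wpM2r u0 K3; have k4u := ler_wpM2r u0 K4.
rewrite /w in gxy cW piz *.
lra.
Qed.

(** * Continuity of Gamma in P and operator bounds *)

Lemma Gamma_continuous A L D zeta Q i j :
  continuous (fun Pt => Gamma A L D zeta Q Pt i j).
Proof.
have PB k k' : continuous (fun Pt : 'M[R]_n => (Pt *m L *m D) k k').
  have -> : (fun Pt : 'M[R]_n => (Pt *m L *m D) k k') =
      fun Pt => \sum_a Pt k a * (L *m D) a k'.
    by apply/funext => Pt; rewrite -mulmxA mxE.
  apply: continuous_sumr => a Pt.
  exact: (cvgM (@coord_continuous R n n k a Pt) (cvg_cst _)).
rewrite /Gamma /sym_block => Pt.
have [k ->|k ->] := split_ordP i; have [k' ->|k' ->] := split_ordP j.
- under eq_fun do rewrite block_mxEul mxE.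
  exact: (cvgM (cvg_cst _) (@coord_continuous R n n k k' Pt)).
- by under eq_fun do rewrite block_mxEur; exact: PB.
- rewrite (_ : (fun _ => _) = fun M => (M *m L *m D) k' k); first exact: PB.
  by apply/funext => M; rewrite block_mxEdl mxE.
- rewrite (_ : (fun _ => _) = fun=> Phi A L D 0 Q k k').
    exact: cst_continuous.
  by apply/funext => M; rewrite block_mxEdr.
Qed.

(** This is [bil_bound] for the single matrix [U^T *m U], with weight 1. *)
Lemma mulmx_sq_bound (k : nat) (U : 'M[R]_(k, n)) :
  \forall K \near +oo, forall x, sq (U *m x) <= K * sq x.
Proof.
have : bounded_set [set U^T *m U]%classic.
  exact/compact_bounded/compact_set1.
move=> /bil_bound; apply: filterS => K UK x.
have := UK _ erefl x x 1 ltr01; rewrite bilMl invr1 !mul1r.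
have -> : bil U (U *m x) x = sq (U *m x) by rewrite /bil /sq mulmxA.
have := ler_norm (sq (U *m x)); lra.
Qed.

End Observer.

(** * The equivalence *)

Theorem theorem3 (R : realType) (l n m p : nat)
  (A : 'I_l -> 'M[R]_n) (D : 'I_l -> 'M[R]_(m, n)) (C : 'M[R]_(p, n))
  (L : 'I_l -> 'M[R]_(n, m)) (zeta T : R)
  (X : 'I_l -> 'M[R]_n) (Pi : 'M[R]_l) (P : 'I_l -> R -> 'M[R]_n)
  (hobs : forall i, observable (A i) (D i))
  (hU : forall i, hurwitz (Umx (A i) (L i) (D i)))
  (hOmega : exists (Omega : 'M[R]_n) (eta : R),
     [/\ posdef Omega, 0 < eta &
         forall i, negdef (Phi (A i) (L i) (D i) eta Omega)])
  (hzeta : 0 < zeta) (hT : 0 < T)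
  (hX : forall i, posdef (X i))
  (hPi : transition_rate_mx Pi)
  (hXineq : forall i,
     negdef ((A i)^T *m X i + X i *m A i
       + \sum_(j | j != i)
           Pi i j *: (Y1 (A j) (X j) zeta T + Y2 (A j) C zeta T - X i)
       + C^T *m C + (2 * zeta) *: X i))
  (hP : forall i, lyapunov_solution (A i) C (X i) zeta T (P i)) :
  (exists (alpha h kappa : R) (Q W : 'M[R]_n) (gamma : R),
     [/\ [/\ 0 < alpha, 0 < h & 0 < kappa],
         [/\ posdef Q, posdef W & 0 < gamma] &
         forall i (t : R), 0 <= t <= T ->
           negdef (Psi (A i) (L i) (D i) zeta alpha h kappa gamma Q W (P i t))])
  <->
  (exists Q : 'M[R]_n,
     posdef Q /\
     forall i (t : R), 0 <= t <= T ->
       negdef (Gamma (A i) (L i) (D i) zeta Q (P i t))).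
Proof.
split=> [[alpha [h [kappa [Q [W [gamma]]]]]]|[Q [Q0 GammaN]]].
  move=> [[alpha0 h0 kappa0] [Q0 W0 gamma0] PsiN].
  exists Q; split=> // i t tT; have [_ _ PT] := hP i.
  apply: (negdef_Gamma_of_Psi alpha0 gamma0 Q0 W0 (hX i) (PsiN i t tT)).
  by rewrite -PT; apply: PsiN; rewrite lexx ltW.
(* Uniformity in t is obtained on the image of P: [uniformly_negdef] asks for continuity on the
   whole space, which Gamma has as a function of the matrix, whereas P is continuous only within
   [0, T]. *)
pose S i : set 'M[R]_n := (P i @` `[0, T])%classic.
have cS i : compact (S i).
  by apply: continuous_compact; [have [] := hP i|exact: segment_compact].
have SP i t : 0 <= t <= T -> S i (P i t).
  by move=> tT; exists t => //; rewrite /= in_itv.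
(* Each condition holds for all large [K] and there are finitely many indices, so one [K] serves
   them all. *)
have : \forall K \near +oo_R, 1 <= K /\ forall i, [/\
    forall M, S i M -> forall v : 'cV[R]_(n + n),
      bil (Gamma (A i) (L i) (D i) zeta Q M) v v <= - K^-1 * sq v,
    forall M, S i M -> forall x y s, 0 < s ->
      2 * `|bil M x y| <= K * (s * sq x + s^-1 * sq y),
    forall x y s, 0 < s -> 2 * `|bil Q x y| <= K * (s * sq x + s^-1 * sq y),
    forall x, sq (Umx (A i) (L i) (D i) *m x) <= K * sq x &
    forall x, sq (L i *m D i *m x) <= K * sq x].
  near=> K; split; first by near: K; exact: nbhs_pinfty_ge.
  near: K; apply: filter_forall => i.
  have G : \forall K \near +oo_R, forall M, S i M -> forall v : 'cV[R]_(n + n),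
      bil (Gamma (A i) (L i) (D i) zeta Q M) v v <= - K^-1 * sq v.
    apply: (uniformly_negdef (cS i)) => [j k|_ [t tT <-]].
      exact: Gamma_continuous.
    by apply: GammaN; move: tT; rewrite /= in_itv.
  have Pb := bil_bound (compact_bounded (cS i)).
  have Qb := bil_bound (compact_bounded (@compact_set1 _ Q)).
  have Ub := mulmx_sq_bound (Umx (A i) (L i) (D i)).
  have Lb := mulmx_sq_bound (L i *m D i).
  near=> K; split; [near: K; exact: G|near: K; exact: Pb| |
    near: K; exact: Ub|near: K; exact: Lb].
  suff : forall M, [set Q]%classic M -> forall x y s, 0 < s ->
    2 * `|bil M x y| <= K * (s * sq x + s^-1 * sq y) by apply.
  by near: K; exact: Qb.
move=> /(@filter_ex _ _ _)[K [K1 KP]].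
have K0 : 0 < K by apply: lt_le_trans K1.
have w1 : 1 <= 16 * K ^+ 4.
  have : 1 <= K ^+ 4 by rewrite exprn_ege1.
  lra.
(* [K^-1 / 32] is the share of the decay rate that [bil_Psi_lt0] allots to each smallness
   condition. *)
have mu01 : 0 < K^-1 / 32 <= 1.
  have : 0 < K^-1 by rewrite invr_gt0.
  have : K^-1 <= 1 by rewrite invf_le1.
  by move=> ? ?; apply/andP; split; lra.
have [alpha [h [kappa [alpha0 h0 kappa0 alphaK [kappaw hw]]]]] :=
  small_parameters K1 w1 mu01.
have w0 : 0 < 16 * K ^+ 4 by apply: lt_le_trans w1.
exists alpha, h, kappa, Q, (16 * K ^+ 4)%:M, (16 * K ^+ 4).
split=> // [|i t tT]; first by split=> //; exact: posdef_scalar.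
have [KG KPt KQ KU KL] := KP i.
split.
  apply: Psi_sym Q0.1 _; last by rewrite tr_scalar_mx.
  exact: negdef_Gamma_sym (GammaN i t tT).
apply: bil_Psi_lt0; rewrite ?(ltW alpha0) //.
- exact/KG/SP.
- exact/KPt/SP.
Unshelve. all: by end_near. Qed.
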